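(* Let $n\ge 1$, let $D\subset\mathbb{E}^n$ be a bounded convex domain with Hilbert metric $h_D$, and let $\{x_k\}_{k\in\mathbb{N}}$ and $\{y_k\}_{k\in\mathbb{N}}$ be two sequences of points in $D$ both converging (in the Euclidean topology) to the same point $\bar{x}\in\partial D$. Then for any fixed $p_0\in D$, $$(x_k|y_k)_{p_0}\longrightarrow\infty\quad\text{as }k\to\infty.$$
   Context: $\mathbb{E}^n$ denotes $n$-dimensional Euclidean space, and $|xy|$ the Euclidean distance between $x,y\in\mathbb{E}^n$. A bounded convex domain is a nonempty bounded open convex subset $D\subset\mathbb{E}^n$; $\partial D$ is its boundary in $\mathbb{E}^n$. The Hilbert metric $h_D:D\times D\to[0,\infty)$ is defined by $h_D(x,x)=0$ and, for $x\neq y$ in $D$, $$h_D(x,y)=\log\frac{|y\bar{x}|\cdot|x\bar{y}|}{|x\bar{x}|\cdot|y\bar{y}|},$$ where $\bar{x},\bar{y}$ are the two intersection points of $\partial D$ with the straight line through $x$ and $y$, labelled so that $|\bar{x}x|<|\bar{x}y|$ and $|\bar{y}x|>|\bar{y}y|$. For $x,y,p_0\in D$ the Gromov product is $$(x|y)_{p_0}:=\frac12\Big[h_D(x,p_0)+h_D(y,p_0)-h_D(x,y)\Big].$$ *)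

(* Defs.v *)
From mathcomp Require Export all_boot all_order all_algebra.
From mathcomp Require Export all_classical all_reals all_analysis.
Export numFieldNormedType.Exports.

Set Implicit Arguments.
Unset Strict Implicit.
Unset Printing Implicit Defensive.

Import Order.TTheory GRing.Theory Num.Theory.

Local Open Scope classical_set_scope.
Local Open Scope ring_scope.

(* E^n is 'rV[R]_n. The norm `|x| that the library puts on it is the sup norm,
   so the Euclidean distance has to be defined separately; the library topology
   on 'rV[R]_n (entrywise convergence) and the library notion of bounded set
   coincide with the Euclidean ones. *)
Definition eucl_dist (R : realType) (n : nat) (x y : 'rV[R]_n) : R :=
  Num.sqrt (\sum_(i < n) (x ord0 i - y ord0 i) ^+ 2).

Definition boundary (T : topologicalType) (A : set T) : set T :=
  closure A `\` interior A.

Definition line (R : realType) (n : nat) (x y : 'rV[R]_n) : set 'rV[R]_n :=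
  [set x + t *: (y - x) | t in [set: R]].

Definition bounded_convex_domain (R : realType) (n : nat)
    (D : set 'rV[R]_n) : Prop :=
  [/\ D !=set0, bounded_set D, open D & convex_set D].

(* For x != y in a bounded convex domain D, exactly one of the two points of
   the line through x and y on the boundary of D is closer to y than to x:
   the endpoint of the chord lying beyond y. *)
Definition chord_end (R : realType) (n : nat) (D : set 'rV[R]_n)
    (x y : 'rV[R]_n) : 'rV[R]_n :=
  get [set z | [/\ line x y z, boundary D z & eucl_dist z x > eucl_dist z y]].

(* Only meaningful for x and y in D. *)
Definition hilbert_dist (R : realType) (n : nat) (D : set 'rV[R]_n)
    (x y : 'rV[R]_n) : R :=
  if x == y then 0
  else let xbar := chord_end D y x in
       let ybar := chord_end D x y in
       ln ((eucl_dist y xbar * eucl_dist x ybar) / (eucl_dist x xbar * eucl_dist y ybar)).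

Definition gromov_product (R : realType) (n : nat) (D : set 'rV[R]_n)
    (p0 x y : 'rV[R]_n) : R :=
  2^-1 * (hilbert_dist D x p0 + hilbert_dist D y p0 - hilbert_dist D x y).

(* Main.v *)
Require Import Defs.
From mathcomp Require Import ring lra.

Set Implicit Arguments.
Unset Strict Implicit.
Unset Printing Implicit Defensive.

Import Order.TTheory GRing.Theory Num.Theory.
Local Open Scope classical_set_scope.
Local Open Scope ring_scope.

(** For [x != y] in [D] let [z] be the end of the chord beyond [y], and write
[y] as a barycentre [(1 - a) z + a x].  The weight [a = |y z| / |x z|], called
[end_gap D x y] below, lies in (0, 1), and the Hilbert distance splits as
[h(x, y) = - ln a(x, y) - ln a(y, x)] ([hilbert_dist_gap]).  Since all points
involved are collinear, [a] is a ratio of affine parameters: the Euclidean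
distance can be forgotten, and the estimates below use the sup norm.

Fix a ball of radius [r] around [p] inside [D].  Two facts compare [a(p, x)],
which is small when [x] is near the boundary, with [a(y, x)]:
- by convexity the homothety centred at the end of the chord from [p] through
  [x], with ratio [a(p, x)], carries the ball around [p] to a ball of radius
  [a(p, x) r] around [x] inside [D] ([end_gap_ball]);
- a ball of radius [rho] around [x] inside [D] keeps the end of the chord from
  [y] through [x] at distance at least [rho] from [x], which forces
  [rho <= a(y, x) (rho + |x - y|)] ([ball_end_gap]).
As the limit point [q] is outside [D], the first fact also gives
[a(p, x) r <= |x - q|], whence
[a(p, x) r <= a(y, x) (|x - q| + |x - y|)] ([end_gap_ratio]).
The factors [a(x, p)] and [a(y, p)] are at most 1 and only increase the Gromov
product, so adding the logarithms of this inequality and of the one with [x]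
and [y] exchanged gives
[(x|y)_p >= ln (r / (|x - q| + |y - q| + |x - y|))] ([gromov_product_ge]),
which tends to infinity when [x] and [y] tend to [q]. *)

(** * Convex sets in normed spaces *)

Lemma convex_comb (R : realType) (V : normedModType R) (D : set V) (a : R) (x y : V) :
  convex_set D -> 0 <= a <= 1 -> D x -> D y -> D ((1 - a) *: x + a *: y).
Proof.
move=> cD a01 Dx Dy; have /andP[a0 a1] := a01.
have ai : Itv.spec (@Itv.num_sem R)
    (Itv.Real `[0%Z, 1%Z]) (a : R).
  by rewrite /= /Itv.num_sem /= num_real in_itv /= a0 a1.
have := cD y x (Itv.mk ai) (mem_set Dy) (mem_set Dx).
by rewrite inE addrC.
Qed.

(** The image of the ball around [p] under the homothety of centre [z] stays in
[D] even when [z] is only a limit of points of [D]: moving [z] slightly inside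
[D] costs less than the room left in the open ball. *)
Lemma convex_closure_ball (R : realType) (V : normedModType R) (D : set V)
    (p z : V) (r a : R) :
  convex_set D -> ball p r `<=` D -> closure D z -> 0 < a <= 1 ->
  ball ((1 - a) *: z + a *: p) (a * r) `<=` D.
Proof.
move=> cD pD clz /andP[a0 a1] w.
set x := (1 - a) *: z + a *: p.
rewrite -ball_normE /= => xw.
(* The slack of [w] in its ball bounds how far [z] may be moved. *)
have d0 : 0 < a * r - `|x - w| by rewrite subr_gt0.
have [z' [Dz']] := clz _ (nbhsx_ballx z _ d0).
rewrite -ball_normE /= => zz'.
(* The point that the homothety centred at [z'] sends to [w]. *)
pose q := a^-1 *: (w - (1 - a) *: z').
have -> : w = (1 - a) *: z' + a *: q.
  by rewrite /q scalerA mulfV ?gt_eqF// scale1r addrC subrK.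
apply: convex_comb => //; first by rewrite (ltW a0).
apply: pD; rewrite -ball_normE /=.
have -> : p - q = a^-1 *: ((x - w) - (1 - a) *: (z - z')).
  rewrite /q /x [(1 - a) *: (z - z')]scalerBr.
  apply: (scalerI (lt0r_neq0 a0)).
  rewrite scalerBr !scalerA mulfV ?gt_eqF// !scale1r.
  by rewrite !opprB (addrC (_ *: z) (_ *: p)) (addrC _ (- (_ *: z))) addrACA addrK (addrC (- w)).
rewrite normrZ gtr0_norm ?invr_gt0// mulrC ltr_pdivrMr// (mulrC r).
apply: le_lt_trans (ler_normB _ _) _.
rewrite -ltrBrDl normrZ ger0_norm ?subr_ge0//.
apply: le_lt_trans zz'.
by rewrite ler_piMl// gerBl ltW.
Qed.

(** The exit point is at the supremum of the parameters whose point is in [D]: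
boundedness makes it finite and openness keeps the point itself out of [D]. *)
Lemma ray_exit (R : realType) (V : normedModType R) (D : set V) (x v : V) :
  bounded_set D -> open D -> D x -> v != 0 ->
  exists t : R, [/\ 0 <= t, closure D (x + t *: v) & ~ D (x + t *: v)].
Proof.
move=> bD oD Dx v0.
pose g (t : R) : V := x + t *: v.
have gc : continuous g.
  by move=> t; apply: cvgD; [exact: cvg_cst | apply: cvgZr_tmp; exact: cvg_id].
pose S := [set t : R | 0 <= t /\ D (g t)].
have S0 : S 0 by split=> //; rewrite /g scale0r addr0.
have ubS : has_ubound S.
  have [M _ DM] := pinfty_ex_gt0 bD.
  exists ((M + `|x|) / `|v|) => t [t0 Dt].
  rewrite ler_pdivlMr ?normr_gt0//.
  have := DM _ Dt; rewrite /= => gM.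
  have -> : t * `|v| = `|g t - x| by rewrite /g addrAC subrr add0r normrZ ger0_norm.
  by apply: le_trans (ler_normB _ _) _; rewrite lerD2r.
have s0 : 0 <= sup S by exact: ub_le_sup.
exists (sup S); split=> //.
- move=> B /gc gB.
  have [t [[t0 Dt] Bt]] := closure_sup (ex_intro _ 0 S0) ubS gB.
  by exists (g t).
- move=> Ds.
  have /nbhs_ballP[e /= e0 se] : nbhs (sup S) (g @^-1` D).
    by apply: gc; exact: open_nbhs_nbhs.
  have : S (sup S + e / 2).
    split; first by rewrite addr_ge0// divr_ge0// ltW.
    apply: se; rewrite -ball_normE /= opprD addrA subrr add0r normrN.
    by rewrite gtr0_norm ?divr_gt0//; lra.
  by move/(ub_le_sup ubS); lra.
Qed.

(** * Ends of chords *)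

Lemma eucl_dist_affine (R : realType) (n : nat) (x v : 'rV[R]_n) (s t : R) :
  eucl_dist (x + s *: v) (x + t *: v) = `|s - t| * eucl_dist v 0.
Proof.
rewrite /eucl_dist -sqrtr_sqr -sqrtrM ?sqr_ge0// mulr_sumr; congr Num.sqrt.
by apply: eq_bigr => i _; rewrite !mxE; ring.
Qed.

Lemma eucl_dist0_gt0 (R : realType) (n : nat) (v : 'rV[R]_n) :
  v != 0 -> 0 < eucl_dist v 0.
Proof.
move=> v0; rewrite /eucl_dist sqrtr_gt0 lt0r sumr_ge0 ?andbT; last first.
  by move=> i _; exact: sqr_ge0.
apply: contra v0; rewrite psumr_eq0; last by move=> i _; exact: sqr_ge0.
move=> /allP v0; apply/eqP/rowP => i.
by have := v0 i (mem_index_enum i); rewrite !mxE subr0 sqrf_eq0 => /eqP.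
Qed.

Lemma line_exit_gt1 (R : realType) (n : nat) (D : set 'rV[R]_n)
    (x y : 'rV[R]_n) (t : R) :
  convex_set D -> D x -> D y -> 0 <= t -> ~ D (x + t *: (y - x)) -> 1 < t.
Proof.
move=> cD Dx Dy t0; apply: contra_notT; rewrite -leNgt => t1.
have := convex_comb (a := t) cD _ Dx Dy; rewrite t0 t1 => /(_ isT).
by congr D; rewrite scalerBl scale1r scalerBr addrA addrAC.
Qed.

Lemma eucl_dist_line (R : realType) (n : nat) (x y : 'rV[R]_n) (t : R) :
  let z := x + t *: (y - x) in
  eucl_dist x z = `|t| * eucl_dist (y - x) 0 /\
  eucl_dist y z = `|t - 1| * eucl_dist (y - x) 0.
Proof.
split.
  have := eucl_dist_affine x (y - x) 0 t.
  by rewrite scale0r addr0 sub0r normrN.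
have := eucl_dist_affine x (y - x) 1 t.
by rewrite scale1r (addrC x (y - x)) subrK distrC.
Qed.

Lemma eucl_distC (R : realType) (n : nat) (x y : 'rV[R]_n) :
  eucl_dist x y = eucl_dist y x.
Proof.
by rewrite /eucl_dist; congr Num.sqrt; apply: eq_bigr => i _; rewrite -sqrrN opprB.
Qed.

(** The set of candidates in the definition of [chord_end] is inhabited by the
exit point of the ray from [x] through [y].  Conversely any candidate, being
closer to [y] than to [x], has a nonnegative parameter, and it lies beyond [y]
because the whole segment is in [D]. *)
Lemma chord_endP (R : realType) (n : nat) (D : set 'rV[R]_n) (x y : 'rV[R]_n) :
  bounded_convex_domain D -> D x -> D y -> x != y ->
  exists t : R, [/\ 1 < t, chord_end D x y = x + t *: (y - x),
    closure D (chord_end D x y) & ~ D (chord_end D x y)].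
Proof.
move=> [_ bD oD cD] Dx Dy xy.
have v0 : y - x != 0 by rewrite subr_eq0 eq_sym.
have N0 := eucl_dist0_gt0 v0.
have dE t : (eucl_dist (x + t *: (y - x)) y < eucl_dist (x + t *: (y - x)) x)
    = (`|t - 1| < `|t|).
  have [dx dy] := eucl_dist_line x y t.
  by rewrite ![eucl_dist (x + _) _]eucl_distC dx dy ltr_pM2r.
have iD : interior D = D by apply/interior_id.
rewrite /chord_end; set Q := [set z | _].
have /getPex : exists z, Q z.
  have [t [t0 clt nDt]] := ray_exit bD oD Dx v0.
  have t1 := line_exit_gt1 cD Dx Dy t0 nDt.
  exists (x + t *: (y - x)); split.
  - by exists t.
  - by split=> //; rewrite iD.
  - by rewrite dE !gtr0_norm//; lra.
move: (get Q) => z [[t _ <-]] [clt]; rewrite iD dE => nDt tt.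
have t0 : 0 <= t.
  by rewrite leNgt; apply/negP => t0; move: tt; rewrite !ltr0_norm//; lra.
by exists t; split=> //; exact: (line_exit_gt1 cD Dx Dy).
Qed.

(** The barycentric weight of [x] when [y] is written in terms of [x] and the end
of the chord beyond [y]; the value 1 on the diagonal is the one that makes
[y] equal to [x] itself in that decomposition, and it keeps the formula
[- ln a(x, y) - ln a(y, x)] equal to 0 there. *)
Definition end_gap (R : realType) (n : nat) (D : set 'rV[R]_n)
    (x y : 'rV[R]_n) : R :=
  if x == y then 1
  else eucl_dist y (chord_end D x y) / eucl_dist x (chord_end D x y).

Lemma end_gapP (R : realType) (n : nat) (D : set 'rV[R]_n) (x y : 'rV[R]_n) :
  bounded_convex_domain D -> D x -> D y -> x != y ->
  [/\ 0 < end_gap D x y < 1, closure D (chord_end D x y),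
      ~ D (chord_end D x y) &
      y = (1 - end_gap D x y) *: chord_end D x y + end_gap D x y *: x].
Proof.
move=> hD Dx Dy xy; have [t [t1 zE clz nDz]] := chord_endP hD Dx Dy xy.
have t0 : 0 < t by lra.
have v0 : y - x != 0 by rewrite subr_eq0 eq_sym.
have aE : end_gap D x y = 1 - t^-1.
  have [dx dy] := eucl_dist_line x y t.
  rewrite /end_gap (negbTE xy) zE dx dy -mulf_div divff ?gt_eqF ?eucl_dist0_gt0//.
  by rewrite !gtr0_norm ?subr_gt0// mulr1 mulrBl divff ?gt_eqF// mul1r.
split=> //; rewrite aE.
  by rewrite subr_gt0 invf_lt1// t1 ltrBlDr ltrDl invr_gt0.
rewrite zE opprB addrCA subrr addr0 scalerDr scalerA mulVf ?gt_eqF// scale1r.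
by rewrite scalerBl scale1r [RHS]addrC addrA subrK [RHS]addrC subrK.
Qed.

Lemma end_gap_itv (R : realType) (n : nat) (D : set 'rV[R]_n) (x y : 'rV[R]_n) :
  bounded_convex_domain D -> D x -> D y -> 0 < end_gap D x y <= 1.
Proof.
move=> hD Dx Dy; have [->|xy] := eqVneq x y.
  by rewrite /end_gap eqxx ltr01 lexx.
by have [/andP[-> /ltW ->]] := end_gapP hD Dx Dy xy.
Qed.

(** The cross-ratio is the inverse of the product of the two weights. *)
Lemma hilbert_dist_gap (R : realType) (n : nat) (D : set 'rV[R]_n)
    (x y : 'rV[R]_n) :
  bounded_convex_domain D -> D x -> D y ->
  hilbert_dist D x y = - ln (end_gap D x y) - ln (end_gap D y x).
Proof.
move=> hD Dx Dy; have /andP[a0 _] := end_gap_itv hD Dx Dy.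
have /andP[b0 _] := end_gap_itv hD Dy Dx.
rewrite -opprD -lnM ?posrE// -lnV ?posrE ?mulr_gt0//.
rewrite /hilbert_dist /end_gap (eq_sym y x); case: eqVneq => _.
  by rewrite mulr1 invr1 ln1.
by rewrite mulf_div invf_div [X in _ / X]mulrC [X in X / _]mulrC.
Qed.

(** * Comparison of the gaps *)

Lemma end_gap_ball (R : realType) (n : nat) (D : set 'rV[R]_n)
    (p x : 'rV[R]_n) (r : R) :
  bounded_convex_domain D -> D p -> D x -> ball p r `<=` D ->
  ball x (end_gap D p x * r) `<=` D.
Proof.
move=> hD Dp Dx pD; have [<-|px] := eqVneq p x.
  by rewrite /end_gap eqxx mul1r.
have [/andP[a0 /ltW a1] clz _ {1}->] := end_gapP hD Dp Dx px.
have [_ _ _ cD] := hD.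
by apply: convex_closure_ball => //; rewrite a0 a1.
Qed.

(** With [b = a(y, x)] and [z] the end of the chord beyond [x], the barycentric
relation reads [(1 - b) (x - z) = b (y - x)], and [z] is outside the ball; taking
norms gives [(1 - b) r <= b |x - y|]. *)
Lemma ball_end_gap (R : realType) (n : nat) (D : set 'rV[R]_n)
    (x y : 'rV[R]_n) (r : R) :
  bounded_convex_domain D -> D x -> D y -> ball x r `<=` D ->
  r <= end_gap D y x * (r + `|x - y|).
Proof.
move=> hD Dx Dy xD; have [->|yx] := eqVneq y x.
  by rewrite /end_gap eqxx subrr normr0 addr0 mul1r.
have [/andP[b0 b1] _ nDz xE] := end_gapP hD Dy Dx yx.
set b := end_gap D y x in b0 b1 xE *; set z := chord_end D y x in nDz xE.
have rz : r <= `|x - z|.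
  by rewrite leNgt; apply/negP => xz; apply: nDz; apply: xD; rewrite -ball_normE.
have zE : (1 - b) *: (x - z) = b *: (y - x).
  have bz : (1 - b) *: z = x - b *: y.
    by apply/eqP; rewrite eq_sym subr_eq; apply/eqP.
  rewrite scalerBr bz scalerBl scale1r opprB addrCA [x - _ - x]addrAC subrr.
  by rewrite add0r scalerBr.
have : (1 - b) * r <= b * `|x - y|.
  rewrite distrC -{2}(gtr0_norm b0) -normrZ -zE normrZ gtr0_norm ?subr_gt0//.
  by rewrite ler_pM2l ?subr_gt0.
by rewrite mulrBl mul1r mulrDr lerBlDl.
Qed.

Lemma outside_end_gap (R : realType) (n : nat) (D : set 'rV[R]_n)
    (p x q : 'rV[R]_n) (r : R) :
  bounded_convex_domain D -> D p -> D x -> ball p r `<=` D -> ~ D q ->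
  end_gap D p x * r <= `|x - q|.
Proof.
move=> hD Dp Dx pD nDq; rewrite leNgt; apply/negP => xq; apply: nDq.
by apply: (end_gap_ball hD Dp Dx pD); rewrite -ball_normE.
Qed.

Lemma end_gap_ratio (R : realType) (n : nat) (D : set 'rV[R]_n)
    (p x y q : 'rV[R]_n) (r : R) :
  bounded_convex_domain D -> D p -> D x -> D y -> ball p r `<=` D -> ~ D q ->
  end_gap D p x * r <= end_gap D y x * (`|x - q| + `|x - y|).
Proof.
move=> hD Dp Dx Dy pD nDq; have /andP[b0 _] := end_gap_itv hD Dy Dx.
apply: le_trans (ball_end_gap hD Dx Dy (end_gap_ball hD Dp Dx pD)) _.
by rewrite ler_pM2l// lerD2r outside_end_gap.
Qed.

(** Quantitative form of the divergence of the Gromov product, with a bound that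
depends on [D] and [p] through [r] alone. *)
Lemma gromov_product_ge (R : realType) (n : nat) (D : set 'rV[R]_n)
    (p x y q : 'rV[R]_n) (r : R) :
  bounded_convex_domain D -> D p -> D x -> D y -> 0 < r ->
  ball p r `<=` D -> ~ D q ->
  ln (r / (`|x - q| + `|y - q| + `|x - y|)) <= gromov_product D p x y.
Proof.
move=> hD Dp Dx Dy r0 pD nDq; set E := _ + _ + _.
have half u v : D u -> D v -> `|u - q| + `|u - v| <= E ->
    ln (r / E) <= ln (end_gap D v u) - ln (end_gap D p u).
  move=> Du Dv uE.
  have /andP[a0 _] := end_gap_itv hD Dp Du.
  have /andP[b0 _] := end_gap_itv hD Dv Du.
  have le1 := end_gap_ratio hD Dp Du Dv pD nDq.
  have E0 : 0 < E.
    apply: lt_le_trans uE; rewrite -(pmulr_rgt0 _ b0).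
    by apply: lt_le_trans le1; rewrite mulr_gt0.
  rewrite -ln_div ?posrE// ler_ln ?posrE ?divr_gt0//.
  rewrite ler_pdivlMr// mulrAC ler_pdivrMr// mulrC.
  by apply: le_trans le1 _; rewrite ler_pM2l.
have hx : `|x - q| + `|x - y| <= E by rewrite /E -addrA lerD2l lerDr.
have hy : `|y - q| + `|y - x| <= E.
  by rewrite /E (addrC `|x - q|) -addrA lerD2l (distrC y x) lerDr.
have {}hx := half _ _ Dx Dy hx; have {}hy := half _ _ Dy Dx hy.
have neg u : D u -> ln (end_gap D u p) <= 0.
  by move=> Du; have /andP[_ ?] := end_gap_itv hD Du Dp; exact: ln_le0.
have := neg _ Dx; have := neg _ Dy.
rewrite /gromov_product !hilbert_dist_gap//; lra.
Qed.

Theorem proposition2 (R : realType) (n : nat) (hn : (0 < n)%N)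
    (D : set 'rV[R]_n) (hD : bounded_convex_domain D)
    (x_ y_ : nat -> 'rV[R]_n)
    (hx : forall k, D (x_ k)) (hy : forall k, D (y_ k))
    (xbar : 'rV[R]_n) (hxbar : boundary D xbar)
    (x_cvg : x_ k @[k --> \oo] --> xbar)
    (y_cvg : y_ k @[k --> \oo] --> xbar)
    (p0 : 'rV[R]_n) (hp0 : D p0) :
  gromov_product D p0 (x_ k) (y_ k) @[k --> \oo] --> +oo.
Proof.
have [_ _ oD _] := hD.
have nD : ~ D xbar by have [_] := hxbar; rewrite (interior_id _).1.
have /nbhs_ballP[r /= r0 pD] : nbhs p0 D by exact: open_nbhs_nbhs.
apply/cvgryPge => A.
(* The denominator [|x - q| + |y - q| + |x - y|] is at most twice the sum of its
   first two terms, hence the factor 4. *)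
have e0 : 0 < r / expR A / 4 by rewrite !divr_gt0// expR_gt0.
near=> k.
have xk : `|x_ k - xbar| < r / expR A / 4.
  by near: k; apply: (cvgr_distC_lt _ _).
have yk : `|y_ k - xbar| < r / expR A / 4.
  by near: k; apply: (cvgr_distC_lt _ _).
apply: le_trans (gromov_product_ge hD hp0 (hx k) (hy k) r0 pD nD).
set E := _ + _ + _.
have EA : E < r / expR A.
  have : `|x_ k - y_ k| <= `|x_ k - xbar| + `|y_ k - xbar|.
    by rewrite (distrC (y_ k)) ler_distD.
  rewrite /E; lra.
have E0 : 0 < E.
  rewrite /E -addrA ltr_wpDr ?addr_ge0// normr_gt0 subr_eq0.
  by apply: contra_notN nD => /eqP <-.
rewrite -{1}(expRK A) ler_ln ?posrE ?expR_gt0 ?divr_gt0//.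
by rewrite ler_pdivlMr// mulrC -ler_pdivlMr ?expR_gt0// ltW.
Unshelve. all: by end_near. Qed.
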